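(* Let $N$ be the unique discrete CND for a symmetric nontrivial tradeoff function $f$ at sensitivity $\Delta=1$, and let $N'$ be any integer-valued random variable such that $T(N',N'+1)\geq f$. Then $|N'-a|$ stochastically dominates $|N|$ for all $a\in\mathbb{Z}$. This implies that: - $P(|N|\leq t)\geq P(|N'-a|\leq t)$ for all $a\in\mathbb{Z}$ and all integers $t\geq 0$; - for any non-decreasing function $\phi$, $\mathbb{E}\,\phi(|N|)\leq\mathbb{E}\,\phi(|N'-a|)$ for all $a\in\mathbb{Z}$; - there exists a non-negative, integer-valued random variable $W$ such that $|N'|\overset{d}{=}|N|+W$; if $N'$ is symmetric about zero, then $N'\overset{d}{=}N+\mathrm{sign}(N)\cdot W$.
   Context: For probability distributions $P,Q$ on a common measurable space, the tradeoff function $T(P,Q):[0,1]\to[0,1]$ is $T(P,Q)(\alpha)=\inf\{1-\mathbb{E}_Q(\phi)\mid \mathbb{E}_P(\phi)\leq 1-\alpha\}$, the infimum over measurable tests $\phi$ with values in $[0,1]$. For random variables $X,Y$, $T(X,Y)$ denotes the tradeoff function of their laws. A function $f:[0,1]\to[0,1]$ is a tradeoff function if $f=T(P,Q)$ for some $P,Q$; equivalently, $f$ is convex, continuous, non-decreasing, and $f(x)\leq x$ for all $x\in[0,1]$. It is nontrivial if $f(\alpha)<\alpha$ for some $\alpha\in(0,1)$, and symmetric if $f=T(P,Q)$ implies $f=T(Q,P)$. Inequalities between functions are pointwise. Discrete CND: let $\Delta$ be a positive integer, $f$ a symmetric tradeoff function, and $N$ a random variable with cdf $F$. Then $F$ (or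 $N$) is a discrete CND (discrete canonical noise distribution) for $f$ at sensitivity $\Delta$ if (1) $T(N,N+t)\geq f$ for all $t\in\{-\Delta,\ldots,\Delta\}$; (2) $f(F(t+\Delta))=F(t)$ for all $t\in\mathbb{Z}$ such that $F(t+\Delta)<1$; (3) $N$ takes values in $\mathbb{Z}$ and is symmetric about zero. For a symmetric nontrivial $f$ and $\Delta=1$ a discrete CND exists and is unique. $X$ stochastically dominates $Y$ if $P(X\leq t)\leq P(Y\leq t)$ for all $t\in\mathbb{R}$. $W$ is not necessarily independent of $N$. $\overset{d}{=}$ is equality in distribution, and $\mathrm{sign}$ is the sign function.
   Formalization: In the last clause sign(0) is replaced by a fair ±1 coin independent of (N, W), because with the usual sign (sign(0)=0) the identity fails whenever P(N'=0) < P(N=0), e.g. for N' = N + U with U independent and uniform on {-M,...,M}, M large. *)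

(* Defs.v *)
From HB Require Import structures.
From mathcomp Require Import all_boot all_order all_algebra.
From mathcomp Require Import all_classical all_reals all_analysis.
From mathcomp Require Import measurable_realfun.

Set Implicit Arguments.
Unset Strict Implicit.
Unset Printing Implicit Defensive.

Import Order.TTheory GRing.Theory Num.Theory.

Local Open Scope classical_set_scope.
Local Open Scope ring_scope.

Definition is_test (d : measure_display) (T : measurableType d) (R : realType)
    (phi : T -> R) : Prop :=
  measurable_fun [set: T] phi /\ forall x, 0 <= phi x <= 1.

(* Only the values at alpha in [0, 1] are meaningful: tradeoff functions
   [0, 1] -> [0, 1] are represented by maps R -> R considered on [0, 1].
   The set below is bounded below by 0, and contains 1 when alpha <= 1. *)
Definition tradeoff (d : measure_display) (T : measurableType d) (R : realType)
    (P Q : probability T R) (alpha : R) : R :=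
  inf [set 1 - fine 'E_Q[phi] | phi in
        [set phi : T -> R | is_test phi /\ ('E_P[phi] <= (1 - alpha)%:E)%E]].

Definition eq_on01 (R : realType) (f g : R -> R) : Prop :=
  forall alpha, 0 <= alpha <= 1 -> f alpha = g alpha.

Definition le_on01 (R : realType) (f g : R -> R) : Prop :=
  forall alpha, 0 <= alpha <= 1 -> f alpha <= g alpha.

Definition is_tradeoff (R : realType) (f : R -> R) : Prop :=
  exists (d : measure_display) (T : measurableType d) (P Q : probability T R),
    eq_on01 f (tradeoff P Q).

Definition symmetric_tradeoff (R : realType) (f : R -> R) : Prop :=
  forall (d : measure_display) (T : measurableType d) (P Q : probability T R),
    eq_on01 f (tradeoff P Q) -> eq_on01 f (tradeoff Q P).

Definition nontrivial_tradeoff (R : realType) (f : R -> R) : Prop :=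
  exists2 alpha, 0 < alpha < 1 & f alpha < alpha.

(* T(X, X + t) *)
Definition shift_tradeoff (d : measure_display) (T : measurableType d)
    (R : realType) (P : probability T R) (X : {RV P >-> R}) (t : R) : R -> R :=
  tradeoff (distribution P X)
    (distribution P (X \+ cst t : {mfun T >-> R})).

Definition integer_valued (R : realType) (T : Type) (X : T -> R) : Prop :=
  forall w, X w \is a Num.int.

Definition eq_law (d1 d2 : measure_display)
    (T1 : measurableType d1) (T2 : measurableType d2) (R : realType)
    (P1 : probability T1 R) (P2 : probability T2 R)
    (X : T1 -> R) (Y : T2 -> R) : Prop :=
  forall A : set R, measurable A -> P1 (X @^-1` A) = P2 (Y @^-1` A).

Definition symmetric_law (d : measure_display) (T : measurableType d)
    (R : realType) (P : probability T R) (X : T -> R) : Prop :=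
  eq_law P P X (fun w => - X w).

Definition discrete_CND (d : measure_display) (T : measurableType d)
    (R : realType) (P : probability T R) (f : R -> R) (Delta : nat)
    (N : {RV P >-> R}) : Prop :=
  [/\ forall t : int, `|t| <= Delta%:Z -> le_on01 f (shift_tradeoff N t%:~R),
      forall t : int, (cdf N (t + Delta%:Z)%:~R < 1)%E ->
        f (fine (cdf N (t + Delta%:Z)%:~R)) = fine (cdf N t%:~R),
      integer_valued N
    & symmetric_law P N].

Definition stoch_dominates (d1 d2 : measure_display)
    (T1 : measurableType d1) (T2 : measurableType d2) (R : realType)
    (P1 : probability T1 R) (P2 : probability T2 R)
    (X : T1 -> R) (Y : T2 -> R) : Prop :=
  forall t : R, (P1 [set w | (X w <= t)%R] <= P2 [set w | (Y w <= t)%R])%E.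

(* B is uniform on {-1, 1} and independent of the pair (X, Y). *)
Definition fair_sign_indep (d : measure_display) (T : measurableType d)
    (R : realType) (P : probability T R) (B X Y : T -> R) : Prop :=
  (forall w, B w = 1 \/ B w = -1) /\
  forall A : set (R * R), measurable A ->
    P ([set w | B w = 1] `&` [set w | A (X w, Y w)]) =
    ((2^-1)%:E * P [set w | A (X w, Y w)])%E.

(* The sign of x, with the value b at 0. No constant b in {-1, 0, 1} allows
   N + sign(N) W to have the law of a symmetric N' with P(N' = 0) < P(N = 0):
   if b >= 0 and W >= 0, then N + sign(N) W < 0 iff N < 0, whereas
   P(N' < 0) > P(N < 0) (symmetrically if b <= 0). The sign of 0 is therefore
   drawn at random: b is meant to be a fair sign independent of (N, W). *)
Definition sign_at0 (R : realType) (b x : R) : R :=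
  if x == 0 then b else Num.sg x.

(* Main.v *)
(* Let F and G be the cdfs of N and N'. Threshold tests turn T(N', N' + 1) >= f
   into f (G t) <= G (t - 1), whereas f (F t) = F (t - 1) as long as F t < 1.
   With g = f^(2t+1), x = G (a + t) and y = F t this gives
   P(|N' - a| <= t) <= x - g x and, by symmetry of N, P(|N| <= t) = y - g y with
   g y = 1 - y. Since g is convex and its graph is symmetric with respect to the
   antidiagonal, x - g x is largest at the point y, whence the domination.
   The coupling takes the quantile functions of |N| <= |N'| on [0, 1] and two
   independent fair signs: one is the sign of N, the other one replaces it
   where N = 0. *)
Require Import Defs.
From HB Require Import structures.
From mathcomp Require Import all_boot all_order all_algebra.
From mathcomp Require Import all_classical all_reals all_analysis.
From mathcomp Require Import measurable_realfun.
From mathcomp Require Import ring lra zify.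

Import Order.TTheory GRing.Theory Num.Theory.

Local Open Scope classical_set_scope.
Local Open Scope ring_scope.

(** * Tests and tradeoff functions *)

Section test_functions.
Context {d : measure_display} {T : measurableType d} {R : realType}.
Implicit Types (P Q : probability T R) (phi psi : T -> R) (alpha a b c v x : R).

Lemma is_test_cst c : 0 <= c <= 1 -> is_test (cst c : T -> R).
Proof. by move=> c01; split => //; exact: measurable_cst. Qed.

Lemma is_test_sub1Z c phi : 0 <= c <= 1 -> is_test phi ->
  is_test (fun w => 1 - c * phi w).
Proof.
move=> c01 [mphi phi01]; split.
  by apply: measurable_funB => //; apply: measurable_funM.
by move=> w; have := phi01 w; move=> phi01'; nra.
Qed.

Lemma is_test_mid phi psi : is_test phi -> is_test psi ->
  is_test (fun w => 2^-1 * phi w + 2^-1 * psi w).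
Proof.
move=> [mphi phi01] [mpsi psi01]; split.
  by apply: measurable_funD; apply: measurable_funM.
by move=> w; have := phi01 w; have := psi01 w; lra.
Qed.

Lemma integrable_test P phi : is_test phi ->
  P.-integrable setT (EFin \o phi).
Proof.
move=> [mphi phi01].
apply: (@le_integrable _ _ _ _ _ measurableT _ (EFin \o cst 1)) => //.
- exact/measurable_EFinP.
- move=> w _ /=; rewrite lee_fin normr1 ger0_norm; by case/andP: (phi01 w).
- by apply: finite_measure_integrable_cst.
Qed.

(** A real number rather than an extended one, so that real arithmetic applies; by [EtestE] nothing
    is lost on tests. *)
Definition Etest P phi : R := fine ('E_P[phi])%E.

Lemma EtestE P phi : is_test phi -> 'E_P[phi]%E = (Etest P phi)%:E.
Proof.
move=> /(integrable_test P) iphi; rewrite /Etest fineK// unlock.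
exact: integrable_fin_num.
Qed.

Lemma Etest_cst P c : Etest P (cst c) = c.
Proof. by rewrite /Etest expectation_cst. Qed.

Lemma Etest_lin P a b phi psi : is_test phi -> is_test psi ->
  Etest P (fun w => a * phi w + b * psi w) = a * Etest P phi + b * Etest P psi.
Proof.
move=> tphi tpsi; have ip := integrable_test P _ tphi.
have iq := integrable_test P _ tpsi.
rewrite /Etest unlock.
under eq_integral do rewrite EFinD !EFinM.
rewrite integralD//=; [|exact: integrableZl|exact: integrableZl].
rewrite !integralZl// fineD ?fin_numM ?integrable_fin_num//.
by rewrite !fineM ?integrable_fin_num.
Qed.

Lemma Etest_sub1Z P c phi : is_test phi ->
  Etest P (fun w => 1 - c * phi w) = 1 - c * Etest P phi.
Proof.
move=> tphi; have t1 : is_test (cst 1 : T -> R).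
  by apply: is_test_cst; rewrite ler01 lexx.
transitivity (Etest P (fun w => 1 * cst 1 w + - c * phi w)).
  by congr Etest; apply/funext => w /=; rewrite mul1r mulNr.
by rewrite Etest_lin// Etest_cst mul1r mulNr.
Qed.

Lemma Etest_ge0 P phi : is_test phi -> 0 <= Etest P phi.
Proof.
move=> [_ phi01]; apply/fine_ge0/expectation_ge0 => w.
by case/andP: (phi01 w).
Qed.

Lemma Etest_le1 P phi : is_test phi -> Etest P phi <= 1.
Proof.
move=> tphi; have tc : is_test (fun w => 1 - 1 * phi w).
  by apply: is_test_sub1Z; rewrite ?ler01 ?lexx.
by have := Etest_ge0 P _ tc; rewrite Etest_sub1Z//; lra.
Qed.

Lemma tradeoff_le P Q alpha phi : is_test phi -> Etest P phi <= 1 - alpha ->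
  tradeoff P Q alpha <= 1 - Etest Q phi.
Proof.
move=> tphi le; apply: ge_inf; last first.
  by exists phi => //; split => //; rewrite EtestE// lee_fin.
exists 0 => _ [psi [tpsi _] <-].
by have := Etest_le1 Q _ tpsi; rewrite /Etest; lra.
Qed.

Lemma tradeoff_lt P Q alpha v : alpha <= 1 -> tradeoff P Q alpha < v ->
  exists phi, [/\ is_test phi, Etest P phi <= 1 - alpha & 1 - Etest Q phi < v].
Proof.
move=> a1 /inf_lt[|_ [phi [tphi le] <-] lt].
  (* The zero test makes the set under the infimum nonempty; it has the required level because
     [alpha <= 1]. *)
  exists (1 - Etest Q (cst 0)), (cst 0) => //; split.
    by apply: is_test_cst; rewrite lexx ler01.
  by rewrite expectation_cst lee_fin subr_ge0.
by exists phi; split => //; move: le; rewrite EtestE// lee_fin.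
Qed.

Lemma tradeoff_ge P Q alpha v : alpha <= 1 ->
  (forall phi, is_test phi -> Etest P phi <= 1 - alpha ->
    v <= 1 - Etest Q phi) ->
  v <= tradeoff P Q alpha.
Proof.
move=> a1 H; rewrite leNgt; apply/negP.
move=> /(tradeoff_lt _ _ _ _ a1)[phi [t1 t2]].
by rewrite ltNge H.
Qed.

Lemma tradeoff_ge0 P Q alpha : alpha <= 1 -> 0 <= tradeoff P Q alpha.
Proof.
move=> a1; apply: tradeoff_ge => // phi tphi _.
by rewrite subr_ge0; exact: Etest_le1.
Qed.

Lemma tradeoff_le_id P Q alpha : 0 <= alpha <= 1 -> tradeoff P Q alpha <= alpha.
Proof.
move=> a01; have t : is_test (cst (1 - alpha) : T -> R).
  by apply: is_test_cst; lra.
apply: le_trans (tradeoff_le _ Q alpha _ t _) _; rewrite Etest_cst//; lra.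
Qed.

Lemma tradeoff_homo P Q a b : a <= b -> b <= 1 ->
  tradeoff P Q a <= tradeoff P Q b.
Proof.
move=> ab b1; apply: tradeoff_ge => // phi tphi le.
by apply: tradeoff_le => //; apply: le_trans le _; lra.
Qed.

(** Nearly optimal tests are averaged. Convexity enters the argument only through midpoints. *)
Lemma tradeoff_mid P Q a b : a <= 1 -> b <= 1 ->
  tradeoff P Q ((a + b) / 2) <= (tradeoff P Q a + tradeoff P Q b) / 2.
Proof.
move=> a1 b1; apply/ler_addgt0Pr => e e0.
have [phi [tphi pa qa]] : exists phi, [/\ is_test phi, Etest P phi <= 1 - a
    & 1 - Etest Q phi < tradeoff P Q a + e] by apply: tradeoff_lt => //; lra.
have [psi [tpsi pb qb]] : exists phi, [/\ is_test phi, Etest P phi <= 1 - b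
    & 1 - Etest Q phi < tradeoff P Q b + e] by apply: tradeoff_lt => //; lra.
apply: le_trans (tradeoff_le _ _ _ _ (is_test_mid _ _ tphi tpsi) _) _;
  rewrite Etest_lin//; lra.
Qed.

(* If [phi] is nearly optimal for (P, Q) at [x], then [1 - (1 - e) phi] is a
   test for (Q, P); the slack e = v - (1 - E_Q phi) makes the bound strict. *)
Lemma tradeoff_dual_lt P Q x v : x < 1 -> tradeoff P Q x < v -> v <= 1 ->
  tradeoff Q P (1 - v) < 1 - x.
Proof.
move=> x1 /(tradeoff_lt _ _ _ _ (ltW x1))[phi [tphi px qv]] v1.
have q0 := Etest_le1 Q _ tphi; have p0 := Etest_ge0 P _ tphi.
pose e := v - (1 - Etest Q phi).
have t : is_test (fun w => 1 - (1 - e) * phi w).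
  by apply: is_test_sub1Z => //; rewrite /e; lra.
apply: le_lt_trans (tradeoff_le _ _ _ _ t _) _; rewrite Etest_sub1Z// /e; nra.
Qed.

(** Replaces [tradeoff_dual_lt] at [x = 1], where a strict bound by [1 - x = 0] is impossible: a
    test with mean 0 under [P] has a complement with mean 1. *)
Lemma tradeoff_dual1 P Q v : tradeoff P Q 1 < v -> tradeoff Q P (1 - v) <= 0.
Proof.
move=> /(tradeoff_lt _ _ _ _ (lexx _))[phi [tphi px qv]].
have p0 := Etest_ge0 P _ tphi.
have t : is_test (fun w => 1 - 1 * phi w).
  by apply: is_test_sub1Z; rewrite ?ler01 ?lexx.
apply: le_trans (tradeoff_le _ _ _ _ t _) _; rewrite Etest_sub1Z//; lra.
Qed.

End test_functions.

(** * Iterates of a convex function with a symmetric graph *)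

Section symmetric_point.
Context {R : realFieldType} (f : R -> R).
Hypothesis f_ge0 : forall x, 0 <= x <= 1 -> 0 <= f x.
Hypothesis f_le_id : forall x, 0 <= x <= 1 -> f x <= x.
Hypothesis f_homo : forall x y, 0 <= x -> x <= y -> y <= 1 -> f x <= f y.
Hypothesis f_mid : forall x y, 0 <= x <= 1 -> 0 <= y <= 1 ->
  f ((x + y) / 2) <= (f x + f y) / 2.
(** Symmetry of the graph under [(x, y) -> (1 - y, 1 - x)], phrased with inequalities since [f] may
    have flat pieces and no inverse. *)
Hypothesis f_dual : forall x v, 0 <= x < 1 -> f x < v -> v <= 1 ->
  f (1 - v) < 1 - x.
Hypothesis f_dual1 : forall v, f 1 < v -> v <= 1 -> f (1 - v) <= 0.

Lemma iter_itv k x : 0 <= x <= 1 -> 0 <= iter k f x <= x.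
Proof.
move=> x01; elim: k => [|k IH] /=; first by case/andP: x01 => ->/=.
have h : 0 <= iter k f x <= 1 by lra.
by have := f_ge0 _ h; have := f_le_id _ h; lra.
Qed.

Lemma iter_homo k x y : 0 <= x -> x <= y -> y <= 1 -> iter k f x <= iter k f y.
Proof.
move=> x0 xy y1; elim: k => //= k IH.
have hx : 0 <= x <= 1 by lra.
have hy : 0 <= y <= 1 by lra.
have := iter_itv k _ hx; have := iter_itv k _ hy => iy ix.
by apply: f_homo => //; lra.
Qed.

(** Monotonicity of [f] carries the midpoint inequality through each composition. *)
Lemma iter_mid k x y : 0 <= x <= 1 -> 0 <= y <= 1 ->
  iter k f ((x + y) / 2) <= (iter k f x + iter k f y) / 2.
Proof.
move=> x01 y01; elim: k => //= k IH.
have xy01 : 0 <= (x + y) / 2 <= 1 by lra.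
have := iter_itv k _ x01; have := iter_itv k _ y01 => iy ix.
have := iter_itv k _ xy01 => ixy.
apply: le_trans (f_homo _ _ _ IH _) _; [lra|lra|].
by apply: f_mid; lra.
Qed.

(** [f_dual] moves the outermost [f] from the side of [x] to that of [1 - v], and induction moves
    the others. The strict conclusion of [f_dual] supplies the strict premise of the induction
    hypothesis. *)
Lemma iter_dual k x v : 0 <= x <= 1 -> iter k f x < v -> v <= 1 ->
  iter k f (1 - v) <= 1 - x.
Proof.
elim: k x v => [|k IH] x v x01 /=; first by lra.
move=> lt v1; have ix := iter_itv k _ x01.
have gx01 : 0 <= iter k f x <= 1 by lra.
have v0 := f_ge0 _ gx01.
have w01 : 0 <= 1 - v <= 1 by lra.
have fw0 := f_ge0 _ w01; have fw1 := f_le_id _ w01.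
rewrite -iterS iterSr.
have fw01 : 0 <= f (1 - v) <= 1 by lra.
have [gx1|gx1] := ltP (iter k f x) 1.
  have h : f (1 - v) < 1 - iter k f x by apply: f_dual => //; lra.
  have := IH x (1 - f (1 - v)) x01; rewrite subKr.
  by apply; lra.
(* [f_dual] excludes the point 1; here [f_dual1] makes [f (1 - v)] nonpositive, and its iterates
   stay below it. *)
have e1 : iter k f x = 1 by lra.
have : f (1 - v) <= 0 by apply: f_dual1 => //; rewrite -e1.
have := iter_itv k _ fw01; lra.
Qed.

(* By symmetry of the graph of g = f^k under (x, g x) -> (1 - g x, 1 - x) and
   convexity, [x - g x] is largest on the axis of symmetry [g y = 1 - y]; the
   midpoint of [x] and its mirror image compares the two. *)
Lemma iter_gap_max k x y : 0 <= x <= 1 -> 0 <= y <= 1 ->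
  iter k f y = 1 - y -> x - iter k f x <= y - iter k f y.
Proof.
move=> x01 y01 ey; rewrite ey leNgt; apply/negP => lt.
have ix := iter_itv k _ x01.
(* With [g = iter k f], [lt] says [g x < x - (2 y - 1)], and [v] is the middle of this gap:
   [g x < v] allows [iter_dual], while [v < x - (2 y - 1)] puts the midpoint [m] to the right of
   [y]. *)
pose v := (iter k f x + (x - (y - (1 - y)))) / 2.
have := iter_itv k _ y01; rewrite ey => iy.
have v01 : 0 <= 1 - v <= 1 by rewrite /v; lra.
have dv : iter k f (1 - v) <= 1 - x by apply: iter_dual => //; rewrite /v; lra.
have := iter_mid k _ _ x01 v01.
set m := (x + (1 - v)) / 2 => mm.
have m01 : 0 <= m <= 1 by rewrite /m; lra.
have ym : y <= m by rewrite /m /v; lra.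
have : iter k f y <= iter k f m by apply: iter_homo; lra.
(* Contradiction: [1 - y <= g m <= (g x + 1 - x) / 2 < 1 - y]. *)
by rewrite ey; move: mm ym; rewrite /m /v; lra.
Qed.

End symmetric_point.

(** * Distribution functions on the integers *)

Section cdf_shift.
Context {d : measure_display} {T : measurableType d} {R : realType}.
Context {P : probability T R}.
Implicit Types (X : {RV P >-> R}).

Lemma fine_cdfK X r : (fine (cdf X r))%:E = cdf X r.
Proof. by rewrite fineK// fin_num_measure. Qed.

Lemma fine_cdf_itv X r : 0 <= fine (cdf X r) <= 1.
Proof. by rewrite -!lee_fin fine_cdfK cdf_ge0 cdf_le1. Qed.

Lemma fine_cdf_homo X r s : r <= s -> fine (cdf X r) <= fine (cdf X s).
Proof. by move=> rs; rewrite -lee_fin !fine_cdfK; exact: cdf_nondecreasing. Qed.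

Lemma Etest_gt X r :
  Etest (distribution P X) (\1_`]r, +oo[) = 1 - fine (cdf X r).
Proof.
rewrite /Etest expectation_indic// -setCitvl probability_setC//.
by rewrite fineB ?fin_num_measure.
Qed.

Lemma is_test_indic (A : set R) : measurable A ->
  is_test (\1_A : measurableTypeR R -> R).
Proof.
move=> mA; split; first exact: measurable_indic.
by move=> w; rewrite indicE; case: (_ \in _); rewrite ?ler01 ?lexx.
Qed.

(** The test []r, +oo[] has mean exactly [1 - F r] under [X], and its type II error under [X + s] is
    the probability of [X + s <= r]. *)
Lemma shift_tradeoff_cdf X s r :
  shift_tradeoff X s (fine (cdf X r)) <= fine (cdf X (r - s)).
Proof.
apply: le_trans (tradeoff_le _ _ _ (\1_`]r, +oo[) _ _) _.
- exact: is_test_indic.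
- by rewrite Etest_gt.
- rewrite Etest_gt opprB addrCA subrr addr0.
  rewrite -lee_fin !fine_cdfK /cdf /distribution /pushforward.
  rewrite le_measure ?inE//; try exact: measurable_sfunP.
  by move=> w /=; rewrite !in_itv/=; lra.
Qed.

(** On the integers the closed ball is the interval from [a - t - 1], excluded, to [a + t],
    included; hence [t.+1]. *)
Lemma prob_int_ball X (a : int) (t : nat) : integer_valued X ->
  P [set w | `|X w - a%:~R| <= t%:R] =
  (fine (cdf X (a + t%:Z)%:~R) - fine (cdf X (a - t.+1%:Z)%:~R))%:E.
Proof.
move=> Xint.
have mX r : measurable (X @^-1` `]-oo, r]) by exact: measurable_sfunP.
rewrite EFinB !fine_cdfK /cdf /distribution /pushforward.
have -> : [set w | `|X w - a%:~R| <= t%:R] =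
    X @^-1` `]-oo, (a + t%:Z)%:~R] `\` X @^-1` `]-oo, (a - t.+1%:Z)%:~R].
  apply/seteqP; split=> w /=; have /intrP[z ->] := Xint w;
    rewrite !in_itv/= !ler_int -intrB -intr_norm -[t%:R]/(t%:Z%:~R) ler_int;
    lia.
rewrite measureD// ?setIidr//.
  by move=> w /=; rewrite !in_itv/=; move/le_trans; apply; rewrite ler_int; lia.
by rewrite -ge0_fin_numE// fin_num_measure.
Qed.

(** On the integers [- X <= - t - 1] is the negation of [X <= t]. *)
Lemma symmetric_cdfN X (t : int) : integer_valued X -> symmetric_law P X ->
  fine (cdf X (- t - 1)%:~R) = 1 - fine (cdf X t%:~R).
Proof.
move=> Xint symX; apply: EFin_inj; rewrite EFinB !fine_cdfK.
rewrite /cdf /distribution /pushforward symX// -probability_setC//; last first.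
  exact: measurable_sfunP.
congr (P _); apply/seteqP; split=> w /=; have /intrP[z ->] := Xint w;
  rewrite !in_itv/= -intrN !ler_int; lia.
Qed.

End cdf_shift.

(** * Comparison of balls under the two noises *)

Section dominance.
Context {R : realType} {f : R -> R}.
Hypotheses (hf : is_tradeoff f) (hsym : symmetric_tradeoff f).

Lemma is_tradeoff_ge0 x : 0 <= x <= 1 -> 0 <= f x.
Proof.
have [d [T [P [Q fPQ]]]] := hf; move=> x01; rewrite fPQ//.
by apply: tradeoff_ge0; lra.
Qed.

Lemma is_tradeoff_le_id x : 0 <= x <= 1 -> f x <= x.
Proof.
have [d [T [P [Q fPQ]]]] := hf; move=> x01; rewrite fPQ//.
exact: tradeoff_le_id.
Qed.

Lemma is_tradeoff_homo x y : 0 <= x -> x <= y -> y <= 1 -> f x <= f y.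
Proof.
have [d [T [P [Q fPQ]]]] := hf; move=> x0 xy y1.
by rewrite !fPQ; [exact: tradeoff_homo|lra|lra].
Qed.

Lemma is_tradeoff_mid x y : 0 <= x <= 1 -> 0 <= y <= 1 ->
  f ((x + y) / 2) <= (f x + f y) / 2.
Proof.
have [d [T [P [Q fPQ]]]] := hf; move=> x01 y01.
by rewrite !fPQ//; [apply: tradeoff_mid; lra|lra].
Qed.

(** By symmetry [f] is both [T(P, Q)] and [T(Q, P)], so the exchange made by [tradeoff_dual_lt]
    becomes a property of [f] alone. *)
Lemma symmetric_tradeoff_dual x v : 0 <= x < 1 -> f x < v -> v <= 1 ->
  f (1 - v) < 1 - x.
Proof.
have [d [T [P [Q fPQ]]]] := hf; move=> x01 xv v1.
have x01' : 0 <= x <= 1 by lra.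
have v0 := is_tradeoff_ge0 _ x01'.
rewrite (hsym _ _ _ _ fPQ); last by lra.
by apply: tradeoff_dual_lt; rewrite -?fPQ//; lra.
Qed.

Lemma symmetric_tradeoff_dual1 v : f 1 < v -> v <= 1 -> f (1 - v) <= 0.
Proof.
have [d [T [P [Q fPQ]]]] := hf; move=> xv v1.
have x01 : 0 <= (1 : R) <= 1 by lra.
have v0 := is_tradeoff_ge0 _ x01.
rewrite (hsym _ _ _ _ fPQ); last by lra.
by apply: tradeoff_dual1; rewrite -?fPQ//; lra.
Qed.

(** Each step is the threshold bound with shift 1; monotonicity of [f] chains the steps. *)
Lemma iter_cdf_le {d} {T : measurableType d} {P : probability T R}
    (X : {RV P >-> R}) k (t : int) : le_on01 f (shift_tradeoff X 1) ->
  iter k f (fine (cdf X t%:~R)) <= fine (cdf X (t - k%:Z)%:~R).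
Proof.
move=> fX; elim: k => [|k IH] /=; first by rewrite subr0.
have G01 r := fine_cdf_itv X r.
have := iter_itv _ is_tradeoff_ge0 is_tradeoff_le_id k _ (G01 t%:~R) => it.
have G1 := G01 (t - k%:Z)%:~R.
apply: le_trans (is_tradeoff_homo _ _ _ IH _) _; [lra|lra|].
apply: le_trans (fX _ G1) _; apply: le_trans (shift_tradeoff_cdf _ _ _) _.
by rewrite -[X in _ - X]/(1%:~R) -intrB (_ : t - k%:Z - 1 = t - k.+1%:Z)//; lia.
Qed.

(** For the canonical noise the chain consists of equalities. All steps go left, so [F t < 1] at the
    start gives the side condition of each. *)
Lemma iter_cdf_CND {d} {T : measurableType d} {P : probability T R}
    (N : {RV P >-> R}) k (t : int) : discrete_CND f 1 N ->
  fine (cdf N t%:~R) < 1 ->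
  iter k f (fine (cdf N t%:~R)) = fine (cdf N (t - k%:Z)%:~R).
Proof.
move=> [_ Fstep _ _] F1; elim: k => [|k IH] /=; first by rewrite subr0.
rewrite IH; have := Fstep (t - k.+1%:Z).
rewrite (_ : t - k.+1%:Z + 1 = t - k%:Z); last by lia.
apply; rewrite -fine_cdfK lte_fin; apply: le_lt_trans F1.
by apply: fine_cdf_homo; rewrite ler_int; lia.
Qed.

Lemma prob_int_ball_le_CND {d1} {T1 : measurableType d1} {P : probability T1 R}
    (N : {RV P >-> R}) {d2} {T2 : measurableType d2} {P' : probability T2 R}
    (N' : {RV P' >-> R}) (a : int) (t : nat) :
  discrete_CND f 1 N -> integer_valued N' -> le_on01 f (shift_tradeoff N' 1) ->
  (P' [set w | (`|N' w - a%:~R| <= t%:R)%R] <=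
   P [set w | (`|N w| <= t%:R)%R])%E.
Proof.
move=> cnd N'int fN'; have [_ _ Nint Nsym] := cnd.
have := prob_int_ball N 0 t Nint; under eq_set do rewrite subr0; move=> ->.
rewrite prob_int_ball// lee_fin !add0r.
have N01 := fine_cdf_itv N t%:~R; have N'01 := fine_cdf_itv N' (a + t%:Z)%:~R.
have symN := symmetric_cdfN N t Nint Nsym.
rewrite (_ : - t%:Z - 1 = - t.+1%:Z) in symN; last by lia.
have N'2 := fine_cdf_itv N' (a - t.+1%:Z)%:~R.
(* If [F t = 1], symmetry gives [F (- t - 1) = 0]: the ball has probability 1 under [N]. *)
have [F1|F1] := ltP (fine (cdf N t%:~R)) 1; last by rewrite symN; lra.
(* [2 t + 1] steps lead from [t] to [- t - 1], and from [a + t] to [a - t - 1]. *)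
have eN := iter_cdf_CND N (t + t.+1) t cnd F1.
rewrite (_ : t%:Z - (t + t.+1)%N%:Z = - t.+1%:Z) in eN; last by lia.
have iN' := iter_cdf_le N' (t + t.+1) (a + t%:Z) fN'.
rewrite (_ : a + t%:Z - (t + t.+1)%N%:Z = a - t.+1%:Z) in iN'; last by lia.
apply: (@le_trans _ _ (fine (cdf N' (a + t%:Z)%:~R) -
  iter (t + t.+1) f (fine (cdf N' (a + t%:Z)%:~R)))).
  by lra.
rewrite -eN.
(* [eN] and [symN] together put [F t] on the axis of symmetry. *)
apply: (iter_gap_max f is_tradeoff_ge0 is_tradeoff_le_id is_tradeoff_homo
  is_tradeoff_mid symmetric_tradeoff_dual symmetric_tradeoff_dual1) => //.
by rewrite eN.
Qed.

End dominance.

(** * Quantile coupling *)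

Section laws.
Context {d1 d2 : measure_display} {T1 : measurableType d1}
  {T2 : measurableType d2} {R : realType}.
Context {P1 : probability T1 R} {P2 : probability T2 R}.

(** Differences of cdf values give the point masses, and every event is a countable union of
    fibres. *)
Lemma eq_law_nat (X : {RV P1 >-> R}) (Y : {RV P2 >-> R}) :
  (forall w, X w \is a Num.nat) -> (forall w, Y w \is a Num.nat) ->
  (forall n : nat, P1 [set w | X w <= n%:R] = P2 [set w | Y w <= n%:R]) ->
  eq_law P1 P2 X Y.
Proof.
move=> Xnat Ynat XY.
have mle d (T : measurableType d) (P : probability T R) (Z : {RV P >-> R}) r :
    measurable [set w | Z w <= r].
  have -> : [set w | Z w <= r] = Z @^-1` `]-oo, r] by [].
  exact: measurable_sfunP.
have pmfE d (T : measurableType d) (P : probability T R) (Z : {RV P >-> R}) :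
    (forall w, Z w \is a Num.nat) -> forall n : nat,
    P (Z @^-1` [set n%:R]) = (if n is m.+1 then
      P [set w | (Z w <= n%:R)%R] - P [set w | (Z w <= m%:R)%R]
      else P [set w | (Z w <= n%:R)%R])%E.
  move=> Znat [|n]; first congr (P _).
    apply/seteqP; split=> w /=; have /natrP[k ->] := Znat w.
      by move=> ->.
    by rewrite lern0 => /eqP ->.
  transitivity (P ([set w | Z w <= n.+1%:R] `\` [set w | Z w <= n%:R])).
    congr (P _); apply/seteqP; split=> w /=; have /natrP[k ->] := Znat w.
      by move=> /eqP; rewrite eqr_nat => /eqP ->; rewrite !ler_nat; lia.
    by rewrite !ler_nat => kn; congr _%:R; lia.
  rewrite measureD ?setIidr//.
  - by move=> w /=; move/le_trans; apply; rewrite ler_nat.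
  - exact: mle.
  - exact: mle.
  - by rewrite -ge0_fin_numE// fin_num_measure//; exact: mle.
have lawE d (T : measurableType d) (P : probability T R) (Z : {RV P >-> R}) :
    (forall w, Z w \is a Num.nat) -> forall A : set R, P (Z @^-1` A) =
    (\sum_(n <oo | n \in [set n : nat | A n%:R]) P (Z @^-1` [set n%:R]))%E.
  move=> Znat A; rewrite -measure_bigcup//=.
  - congr (P _); apply/seteqP; split=> w /=.
      by have /natrP[n Zn] := Znat w; rewrite Zn => An; exists n.
    by move=> [n An ->].
  - apply/trivIsetP => i j _ _ ij; apply/seteqP; split=> w //= [-> /eqP].
    by rewrite eqr_nat (negPf ij).
move=> A _; rewrite lawE// lawE//; apply: eq_eseriesr => -[|n] _.
  by rewrite !pmfE.
by rewrite !pmfE// !XY.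
Qed.

Lemma eq_law_ge0_integral (X : {RV P1 >-> R}) (Y : {RV P2 >-> R})
    (g : R -> \bar R) : eq_law P1 P2 X Y -> measurable_fun setT g ->
  (forall y, 0 <= g y)%E -> (\int[P1]_w g (X w) = \int[P2]_w g (Y w))%E.
Proof.
move=> XY mg g0.
transitivity (\int[distribution P1 X]_y g y)%E.
  by rewrite ge0_integral_distribution.
transitivity (\int[distribution P2 Y]_y g y)%E; last first.
  by rewrite ge0_integral_distribution.
by apply: eq_measure_integral => A mA _; exact: XY.
Qed.

(** The expectations may be infinite, so the positive and negative parts are transferred
    separately. *)
Lemma eq_law_expectation (X : {RV P1 >-> R}) (Y : {RV P2 >-> R}) (g : R -> R) :
  eq_law P1 P2 X Y -> measurable_fun setT g ->
  ('E_P1[g \o X] = 'E_P2[g \o Y])%E.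
Proof.
move=> XY mg; rewrite unlock integralE [RHS]integralE.
have mg' : measurable_fun setT (EFin \o g) by exact/measurable_EFinP.
congr (_ - _)%E.
- under eq_integral do rewrite funeposE.
  under [RHS]eq_integral do rewrite funeposE.
  apply: (eq_law_ge0_integral X Y (fun r => maxe (g r)%:E 0)%E) => //.
    exact: measurable_maxe.
  by move=> r; rewrite le_max lexx orbT.
- under eq_integral do rewrite funenegE.
  under [RHS]eq_integral do rewrite funenegE.
  apply: (eq_law_ge0_integral X Y (fun r => maxe (- (g r)%:E) 0)%E) => //.
    by apply: measurable_maxe => //; exact: measurableT_comp.
  by move=> r; rewrite le_max lexx orbT.
Qed.

End laws.

Section expectation_mono.
Context {d : measure_display} {T : measurableType d} {R : realType}.
Context (P : probability T R).

Lemma le_expectation (X Y : T -> R) : measurable_fun setT X ->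
  measurable_fun setT Y -> (forall w, X w <= Y w) -> ('E_P[X] <= 'E_P[Y])%E.
Proof.
move=> mX mY XY; rewrite unlock integralE [leRHS]integralE.
have mEX : measurable_fun setT (EFin \o X) by exact/measurable_EFinP.
have mEY : measurable_fun setT (EFin \o Y) by exact/measurable_EFinP.
apply: leeB; apply: ge0_le_integral => //.
- exact: measurable_funepos.
- exact: measurable_funepos.
- by move=> w _; rewrite !funeposE ge_max !le_max lexx lee_fin XY orbT.
- exact: measurable_funeneg.
- exact: measurable_funeneg.
- by move=> w _; rewrite !funenegE ge_max !le_max lexx leeN2 lee_fin XY orbT.
Qed.

End expectation_mono.

(** * Quantile functions with natural values *)

Section quantile.
Context {R : realType}.
Implicit Types (F : nat -> R) (u : R) (n : nat).

(* The value 0 for all [u >= 1], whatever F, keeps quantiles of ordered cdfs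
   ordered everywhere. *)
Definition nat_quantile F u : nat :=
  if pselect (exists n, u <= F n) is left Fu then
    if u < 1 then ex_minn Fu else 0%N
  else 0%N.

(** The adjunction between quantile and cdf. The second disjunct comes from the default value 0,
    which is below every [n]. *)
Lemma nat_quantile_le F u n : {homo F : i j / (i <= j)%N >-> i <= j} ->
  (forall v, v < 1 -> exists n, v <= F n) ->
  (nat_quantile F u <= n)%N = (u <= F n) || (1 <= u).
Proof.
move=> Fhomo F1; rewrite /nat_quantile; case: pselect => [Fu|nFu].
  have [u1|u1] := ltP u 1; last by rewrite orbT.
  rewrite orbF; case: ex_minnP => m um min; apply/idP/idP => [mn|/min//].
  exact: le_trans um (Fhomo _ _ mn).
have [u1|u1] := ltP u 1; last by rewrite orbT.
by case: nFu; exact: F1.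
Qed.

Lemma nat_quantile_ge1 F u : 1 <= u -> nat_quantile F u = 0%N.
Proof.
by move=> u1; rewrite /nat_quantile; case: pselect => // ?; rewrite ltNge u1.
Qed.

Lemma measurable_nat_quantile F : {homo F : i j / (i <= j)%N >-> i <= j} ->
  (forall v, v < 1 -> exists n, v <= F n) ->
  measurable_fun setT (fun u => (nat_quantile F u)%:R : R).
Proof.
move=> Fhomo F1.
(* Factoring through [nat] leaves only countably many fibres to check, each a difference of sublevel
   sets. *)
have mnat : measurable_fun setT (fun n : nat => n%:R : R) by [].
apply: (measurableT_comp mnat); move=> _ A _; rewrite setTI.
have mle n : measurable [set u | (nat_quantile F u <= n)%N].
  rewrite (_ : mkset _ = `]-oo, F n] `|` `[1, +oo[).
    by apply: measurableU.
  apply/seteqP; split=> u /=; rewrite nat_quantile_le// !in_itv/= andbT.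
    by move/orP.
  by move/orP.
rewrite (_ : _ @^-1` A = \bigcup_(n in A) [set u | nat_quantile F u = n]).
  apply: bigcup_measurable => -[|n] _.
    rewrite (_ : mkset _ = [set u | (nat_quantile F u <= 0)%N])//.
    by apply/seteqP; split=> u /=; lia.
  rewrite (_ : mkset _ = [set u | (nat_quantile F u <= n.+1)%N] `\`
    [set u | (nat_quantile F u <= n)%N]); first exact: measurableD.
  by apply/seteqP; split=> u /=; lia.
apply/seteqP; split=> u /= => [Au|[n /[swap] <-]//].
by exists (nat_quantile F u).
Qed.

Lemma uniform01E (A : set R) : measurable A ->
  uniform_prob (@ltr01 R) A = lebesgue_measure (A `&` `[0, 1]).
Proof.
move=> mA; rewrite /uniform_prob integral_uniform_pdf.
rewrite (eq_integral (cst 1%E)); last first.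
  move=> u; rewrite inE => -[_ /=]; rewrite in_itv /uniform_pdf /= => ->.
  by rewrite subr0 invr1.
by rewrite integral_cst//= ?mul1e//; exact: measurableI.
Qed.

(** Within [[0, 1]] the event is [[0, F n]] together with the null set [[set 1]], an artefact of the
    default value. *)
Lemma uniform01_nat_quantile F n : {homo F : i j / (i <= j)%N >-> i <= j} ->
  (forall v, v < 1 -> exists n, v <= F n) -> (forall n, 0 <= F n <= 1) ->
  uniform_prob (@ltr01 R) [set u | ((nat_quantile F u)%:R <= n%:R :> R)%R] =
  (F n)%:E.
Proof.
move=> Fhomo F1 F01; have /andP[Fn0 Fn1] := F01 n.
rewrite (_ : mkset _ = `]-oo, F n] `|` `[1, +oo[); last first.
  apply/seteqP; split=> u /=; rewrite ler_nat nat_quantile_le// !in_itv/= andbT.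
    by move/orP.
  by move/orP.
rewrite uniform01E; last exact: measurableU.
(* When [F n = 1] the two pieces overlap, so additivity is reserved for [F n < 1]. *)
move: Fn1; rewrite le_eqVlt => /orP[/eqP Fn1|Fn1].
  rewrite (_ : _ `&` _ = `[0, 1]%classic).
    by rewrite lebesgue_measure_itv/= lte_fin ltr01 sube0 Fn1.
  apply/seteqP; split=> u /=; rewrite !in_itv/= ?andbT; first by case.
  by move=> u01; split => //; left; rewrite Fn1; case/andP: u01.
rewrite (_ : _ `&` _ = `[0, F n] `|` [set 1]); last first.
  apply/seteqP; split=> u /=; rewrite !in_itv/= ?andbT.
    move=> [[uF|u1] u01]; [left|right]; first by lra.
    by apply/eqP; lra.
  move=> [uF|->]; first by split; [left|]; lra.
  by split; [right|]; lra.
rewrite measureU//; last first.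
  by apply/seteqP; split=> u //= [] /[swap] ->; rewrite in_itv/=; lra.
have /= -> := lebesgue_measure_set1 (1 : R).
rewrite adde0 lebesgue_measure_itv/= lte_fin.
case: ltgtP Fn0 => // [_ _|<- _]; first by rewrite sube0.
by [].
Qed.

End quantile.

Section coupling.
Context {d1 d2 : measure_display} {T1 : measurableType d1}
  {T2 : measurableType d2} {R : realType}.
Context {P1 : probability T1 R} {P2 : probability T2 R}.

Definition nat_cdf {d} {T : measurableType d} {P : probability T R}
  (X : {RV P >-> R}) (n : nat) : R := fine (cdf X n%:R).

Lemma nat_cdf_homo {d} {T : measurableType d} {P : probability T R}
  (X : {RV P >-> R}) : {homo nat_cdf X : i j / (i <= j)%N >-> i <= j}.
Proof.
move=> i j ij; apply: fine_le; rewrite ?fin_num_measure//.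
by apply: cdf_nondecreasing; rewrite ler_nat.
Qed.

Lemma nat_cdf_itv {d} {T : measurableType d} {P : probability T R}
  (X : {RV P >-> R}) n : 0 <= nat_cdf X n <= 1.
Proof.
by rewrite -!lee_fin fineK ?fin_num_measure// cdf_ge0 cdf_le1.
Qed.

Lemma nat_cdf_cvg1 {d} {T : measurableType d} {P : probability T R}
  (X : {RV P >-> R}) v : v < 1 -> exists n, v <= nat_cdf X n.
Proof.
move=> v1; have := cvg_comp _ _ (@cvgr_idn R) (cvg_cdfy1 X).
move/fine_cvgP => [_] /cvgrPdist_lt /(_ (1 - v)).
rewrite subr_gt0 => /(_ v1) [n _ /(_ _ (leqnn n))] /=; rewrite ltr_distlC.
by move=> /andP[h _]; exists n; rewrite /nat_cdf; lra.
Qed.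

(** Both quantile functions are evaluated at the same uniform point; the smaller cdf has the larger
    quantile. *)
Lemma stoch_le_nat_coupling (X : {RV P1 >-> R}) (Y : {RV P2 >-> R}) :
  (forall w, X w \is a Num.nat) -> (forall w, Y w \is a Num.nat) ->
  (forall n : nat,
    P2 [set w | (Y w <= n%:R)%R] <= P1 [set w | (X w <= n%:R)%R])%E ->
  exists (d : measure_display) (S : measurableType d) (U : probability S R)
    (x y : {RV U >-> R}), [/\ eq_law U P1 x X, eq_law U P2 y Y,
    forall u, x u \is a Num.nat, forall u, y u \is a Num.nat
    & forall u, x u <= y u].
Proof.
move=> Xnat Ynat YX.
have mx := measurable_nat_quantile _ (nat_cdf_homo X) (nat_cdf_cvg1 X).
have my := measurable_nat_quantile _ (nat_cdf_homo Y) (nat_cdf_cvg1 Y).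
pose qx (u : measurableTypeR R) : R := (nat_quantile (nat_cdf X) u)%:R.
pose qy (u : measurableTypeR R) : R := (nat_quantile (nat_cdf Y) u)%:R.
pose x : {mfun measurableTypeR R >-> R} :=
  HB.pack qx (isMeasurableFun.Build _ _ _ _ qx mx).
pose y : {mfun measurableTypeR R >-> R} :=
  HB.pack qy (isMeasurableFun.Build _ _ _ _ qy my).
exists _, (measurableTypeR R), (uniform_prob (@ltr01 R)), x, y; split.
- apply: eq_law_nat => // [u|n]; first exact: rpred_nat.
  apply: etrans (uniform01_nat_quantile _ n (nat_cdf_homo X)
    (nat_cdf_cvg1 X) (nat_cdf_itv X)) _.
  by rewrite fineK// fin_num_measure.
- apply: eq_law_nat => // [u|n]; first exact: rpred_nat.
  apply: etrans (uniform01_nat_quantile _ n (nat_cdf_homo Y)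
    (nat_cdf_cvg1 Y) (nat_cdf_itv Y)) _.
  by rewrite fineK// fin_num_measure.
- by move=> u; exact: rpred_nat.
- by move=> u; exact: rpred_nat.
- move=> u /=; rewrite ler_nat.
  (* Both quantiles take the default value beyond 1, so the order holds everywhere and not just
     almost surely. *)
  have [u1|u1] := leP 1 u; first by rewrite !nat_quantile_ge1.
  rewrite nat_quantile_le; [|exact: nat_cdf_homo|exact: nat_cdf_cvg1].
  (* With [q] the quantile of [Y], [u <= F_Y q <= F_X q], so the quantile of [X] is at most [q]. *)
  have : (nat_quantile (nat_cdf Y) u <= nat_quantile (nat_cdf Y) u)%N by [].
  rewrite {1}nat_quantile_le; [|exact: nat_cdf_homo|exact: nat_cdf_cvg1].
  rewrite [1 <= u]leNgt u1 orbF /= => /le_trans ->//.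
  apply: fine_le; rewrite ?fin_num_measure//; exact: YX.
Qed.

End coupling.

(** * Random signs *)

Section symmetrization.
Context {d : measure_display} {T : measurableType d} {R : realType}.
Context {P : probability T R}.
Implicit Types (A B C : set T).

(** Exchanging [B] and [C] off [A] moves mass between the two sets but keeps the total. Here [A]
    will be a sign event, then the event [x <> 0]. *)
Lemma prob_swap A B C : measurable A -> measurable B -> measurable C ->
  (P (A `&` B `|` ~` A `&` C) + P (A `&` C `|` ~` A `&` B) = P B + P C)%E.
Proof.
move=> mA mB mC; have mA' := measurableC mA.
have disj X Y : A `&` X `&` (~` A `&` Y) = set0.
  by rewrite setIACA setICr set0I.
have split X : measurable X -> (P X = P (A `&` X) + P (~` A `&` X))%E.
  move=> mX; rewrite -measureU//; [|exact: measurableI..].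
  by rewrite -setIUl setUv setTI.
rewrite !measureU//; do ?[exact: measurableI].
rewrite (split B)// (split C)// -!addeA; congr (_ + _)%E.
by rewrite [LHS]addeC -[LHS]addeA [RHS]addeCA.
Qed.

Lemma measurable_preimage (X : {RV P >-> R}) (A : set R) : measurable A ->
  measurable (X @^-1` A).
Proof. by move=> mA; exact: measurable_sfunP. Qed.

Lemma measurable_oppset (A : set R) : measurable A ->
  measurable (-%R @^-1` A : set R).
Proof. by move=> mA; rewrite -[_ @^-1` _]setTI; exact: oppr_measurable. Qed.

(** A symmetric law is that of its absolute value times an independent fair sign; both sides are
    doubled to avoid the factor [1/2], restored by [half_double]. *)
Lemma prob_sym_norm (X Xn : {RV P >-> R}) (A : set R) : symmetric_law P X ->
  (forall w, Xn w = `|X w|) -> measurable A ->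
  (P (X @^-1` A) + P (X @^-1` A) =
   P (Xn @^-1` A) + P (Xn @^-1` (-%R @^-1` A)))%E.
Proof.
move=> symX XnE mA; rewrite {1}symX//.
have mnA := measurable_oppset _ mA.
rewrite -[RHS](prob_swap (X @^-1` `[0, +oo[))//; do ?exact: measurable_preimage.
rewrite addeC; congr (P _ + P _)%E; apply/seteqP; split=> w /=;
  rewrite in_itv/= andbT XnE; have [X0|X0] := leP 0 (X w);
  rewrite ?(ger0_norm X0) ?(ltr0_norm X0) ?opprK.
- by move=> AX; left.
- by move=> AX; right.
- by case=> [[]|[/(_ isT)]].
- by case=> [[]|[]].
- by move=> AX; left.
- by move=> AX; right.
- by case=> [[]|[/(_ isT)]].
- by case=> [[]|[]].
Qed.

End symmetrization.

Section fair_coin.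
Context {d : measure_display} {T : measurableType d} {R : realType}.
Context (P : probability T R).

Definition fair_coin : probability bool R := bernoulli_prob (2^-1 : R).

(** This order of integration runs over the coin last, so measures of events are two-term sums. *)
Definition with_coin : probability (T * bool)%type R := (P \x^ fair_coin)%E.

Lemma half_double (x : \bar R) : ((2^-1)%:E * (x + x) = x)%E.
Proof.
case: x => [r| |]; first by rewrite -EFinD -EFinM; congr EFin; lra.
- by rewrite addye// gt0_muley// lte_fin; lra.
- by rewrite addNye gt0_muleNy// lte_fin; lra.
Qed.

Lemma with_coinE (A : set (T * bool)) : with_coin A =
  ((2^-1)%:E * (P [set w | A (w, true)] + P [set w | A (w, false)]))%E.
Proof.
rewrite /with_coin/= /product_measure2 integral_bernoulli_prob//; last by lra.
rewrite /unstable.onem (_ : 1 - 2^-1 = 2^-1 :> R); last by lra.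
rewrite ge0_muleDr//= /ysection; congr (_ * P _ + _ * P _)%E;
  by apply/seteqP; split=> w /=; rewrite inE.
Qed.

Lemma with_coin_fst (A : set T) : with_coin [set w | A w.1] = P A.
Proof. by rewrite with_coinE half_double. Qed.

End fair_coin.

Section coupling_with_signs.
Context {R : realType} {d1 d2 d : measure_display} {T1 : measurableType d1}
  {T2 : measurableType d2} {S : measurableType d}.
Context {P : probability T1 R} {P' : probability T2 R} {U : probability S R}.
Variables (N Nn : {RV P >-> R}) (N' Nn' : {RV P' >-> R}) (x y : {RV U >-> R}).
Hypotheses (symN : symmetric_law P N) (NnE : forall w, Nn w = `|N w|)
  (NnE' : forall w, Nn' w = `|N' w|)
  (xN : eq_law U P x Nn) (yN : eq_law U P' y Nn')
  (xnat : forall u, x u \is a Num.nat) (ynat : forall u, y u \is a Num.nat)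
  (xy : forall u, x u <= y u).

(** [w.1.2] is the coin for the sign of [N0], and [w.2] the coin that replaces it where [N0 = 0]. *)
Let Omega : measurableType _ := (S * bool * bool)%type.
Let mu : probability Omega R := with_coin (with_coin U).

Let coin_sign (b : bool) : R := if b then 1 else -1.

Let N0_fun (w : Omega) : R := coin_sign w.1.2 * x w.1.1.
Let W_fun (w : Omega) : R := y w.1.1 - x w.1.1.
Let B_fun (w : Omega) : R := coin_sign w.2.

Let m11 : measurable_fun setT (fun w : Omega => w.1.1).
Proof. exact: measurableT_comp. Qed.

Let mN0 : measurable_fun setT N0_fun.
Proof.
apply: measurable_funM; last exact: measurableT_comp.
apply: measurableT_comp => //; exact: measurableT_comp.
Qed.

Let mW : measurable_fun setT W_fun.
Proof. by apply: measurable_funB; exact: measurableT_comp. Qed.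

Let mB : measurable_fun setT B_fun.
Proof. exact: measurableT_comp. Qed.

HB.instance Definition _ := isMeasurableFun.Build _ _ _ _ N0_fun mN0.
HB.instance Definition _ := isMeasurableFun.Build _ _ _ _ W_fun mW.
HB.instance Definition _ := isMeasurableFun.Build _ _ _ _ B_fun mB.

Let N0 : {RV mu >-> R} := N0_fun.
Let W : {RV mu >-> R} := W_fun.
Let B : {RV mu >-> R} := B_fun.

Let x_ge0 u : 0 <= x u. Proof. by rewrite natr_ge0. Qed.

Let eq_law_N0 : eq_law mu P N0 N.
Proof.
move=> A mA.
rewrite (with_coin_fst _ [set v | A (coin_sign v.2 * x v.1)]) with_coinE/=.
rewrite -[RHS]half_double (prob_sym_norm N Nn)//.
rewrite -xN// -xN//; last exact: measurable_oppset.
by congr (_ * (U _ + U _))%E; apply/seteqP; split=> u /=;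
  rewrite ?mul1r ?mulN1r.
Qed.

Let fair_sign_B : fair_sign_indep mu B N0 W.
Proof.
have coin_sign1 b : coin_sign b = 1 -> b.
  by case: b => //= /eqP; rewrite eq_sym -addr_eq0 -mulr2n pnatr_eq0.
split=> [w|A mA].
  by rewrite /B /= /B_fun /coin_sign; case: ifP; [left|right].
rewrite (with_coin_fst _ [set v | A (coin_sign v.2 * x v.1, y v.1 - x v.1)]).
rewrite [LHS]with_coinE; congr (_ * _)%E.
(* The outcome [false] means [B = -1], so this section of the event [B = 1] is empty. *)
rewrite (_ : [set w | _ (w, false)] = set0).
  rewrite measure0 adde0; congr (_ _).
  by apply/seteqP; split=> v //= -[].
by apply/seteqP; split=> v //= -[/coin_sign1].
Qed.

Let norm_N0_W w : `|N0 w| + W w = y w.1.1.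
Proof.
have -> : `|N0 w| = x w.1.1; last by rewrite /W/= /W_fun addrC subrK.
rewrite /N0/= /N0_fun normrM [X in _ * X]ger0_norm// /coin_sign.
by case: ifP => _; rewrite ?normrN normr1 mul1r.
Qed.

Let eq_law_norm : eq_law P' mu (fun w => `|N' w|) (fun w => `|N0 w| + W w).
Proof.
move=> A mA; transitivity (P' (Nn' @^-1` A)).
  by congr (P' _); apply/seteqP; split=> w /=; rewrite NnE'.
rewrite -yN// -(with_coin_fst U) -(with_coin_fst (with_coin U)).
by congr (mu _); apply/seteqP; split=> w /=; rewrite -/N0 -/W norm_N0_W.
Qed.

(** The variable is [y] signed by the first coin where [x <> 0] and by the second where [x = 0].
    Equal coins give [y] or [- y]; unequal coins mix the two along [D], and [prob_swap] shows that
    the mixtures have the same total mass. *)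
Let eq_law_sym : symmetric_law P' N' ->
  eq_law P' mu N' (fun w => N0 w + sign_at0 (B w) (N0 w) * W w).
Proof.
move=> symN' A mA.
pose Z e b u := A (coin_sign e * x u +
  sign_at0 (coin_sign b) (coin_sign e * x u) * (y u - x u)).
rewrite /mu with_coinE [X in (X + _)%E]with_coinE [X in (_ + X)%E]with_coinE.
rewrite -[RHS]/((2^-1)%:E * ((2^-1)%:E * (U (Z true true) + U (Z false true)) +
 (2^-1)%:E * (U (Z true false) + U (Z false false))))%E.
pose D := x @^-1` [set~ 0]; pose E := y @^-1` A.
pose F := y @^-1` (-%R @^-1` A).
have mD : measurable D.
  by apply: measurable_preimage; apply: measurableC; exact: measurable_set1.
have mE : measurable E by exact: measurable_preimage.
have mF : measurable F by apply: measurable_preimage; exact: measurable_oppset.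
have ZE e b u : Z e b u =
    A ((if x u == 0 then coin_sign b else coin_sign e) * y u).
  (* If [x = 0] then [W = y]; otherwise [N0] has the sign of its coin, which factors out of
     [x + (y - x)]. *)
  rewrite /Z /sign_at0; have [x0|x0] := eqVneq (x u) 0.
    by rewrite x0 mulr0 eqxx add0r subr0.
  have xgt0 : 0 < x u by rewrite lt_neqAle eq_sym x0 x_ge0.
  rewrite mulf_eq0 (negPf x0) orbF sgrM (gtr0_sg xgt0) mulr1 /coin_sign.
  case: e; first by rewrite oner_eq0 sgr1 !mul1r addrC subrK.
  by rewrite oppr_eq0 oner_eq0 sgrN1 -mulrDr addrC subrK.
have -> : Z true true = E.
  by apply/funext => u; rewrite ZE if_same mul1r.
have -> : Z false false = F.
  by apply/funext => u; rewrite ZE if_same mulN1r.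
have -> : Z true false = D `&` E `|` ~` D `&` F.
  apply/seteqP; split=> u; rewrite /= -/(Z _ _ u) ZE /D /=; case: eqVneq => x0;
    rewrite ?mul1r ?mulN1r.
  - by move=> Au; right; split => // /(_ x0).
  - by move=> Au; left; split => //; exact/eqP.
  - by move=> [[]//|[]//].
  - by move=> [[]//|[/contrapT/eqP]]; rewrite (negPf x0).
have -> : Z false true = D `&` F `|` ~` D `&` E.
  apply/seteqP; split=> u; rewrite /= -/(Z _ _ u) ZE /D /=; case: eqVneq => x0;
    rewrite ?mul1r ?mulN1r.
  - by move=> Au; right; split => // /(_ x0).
  - by move=> Au; left; split => //; exact/eqP.
  - by move=> [[]//|[]//].
  - by move=> [[]//|[/contrapT/eqP]]; rewrite (negPf x0).
rewrite -ge0_muleDr ?adde_ge0// (addeC (U E)) addeACA.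
rewrite (addeC (U (_ `|` _))) prob_swap//.
rewrite half_double -[LHS]half_double (prob_sym_norm N' Nn')//.
rewrite -yN// -yN//; exact: measurable_oppset.
Qed.

Lemma sign_coupling : exists (d : measure_display) (S : measurableType d)
    (mu : probability S R) (N0 W B : {RV mu >-> R}),
  [/\ eq_law mu P N0 N,
      forall w, W w \is a Num.nat,
      eq_law P' mu (fun w => `|N' w|) (fun w => `|N0 w| + W w),
      fair_sign_indep mu B N0 W
    & symmetric_law P' N' ->
      eq_law P' mu N' (fun w => N0 w + sign_at0 (B w) (N0 w) * W w)].
Proof.
exists _, Omega, mu, N0, W, B; split;
  [exact: eq_law_N0| |exact: eq_law_norm|exact: fair_sign_B|exact: eq_law_sym].
move=> w; have := xy w.1.1; rewrite /W /= /W_fun.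
have /natrP[i ->] := xnat w.1.1; have /natrP[j ->] := ynat w.1.1.
by rewrite ler_nat => ij; rewrite -natrB// rpred_nat.
Qed.

End coupling_with_signs.

(** Named so that it can carry the structure of a random variable. *)
Definition norm_sub {d} {T : measurableType d} {R : realType} (X : T -> R)
  (a : R) (w : T) : R := `|X w - a|.

Section norm_sub_rv.
Context {d} {T : measurableType d} {R : realType} (X : {mfun T >-> R}) (a : R).

Let measurable_norm_sub : measurable_fun setT (norm_sub X a).
Proof. by apply: measurableT_comp => //; exact: measurable_funB. Qed.

HB.instance Definition _ :=
  isMeasurableFun.Build _ _ _ _ (norm_sub X a) measurable_norm_sub.

End norm_sub_rv.

Lemma norm_sub_nat {T : Type} {R : realType} (X : T -> R) (a : int) w :
  integer_valued X -> `|X w - a%:~R| \is a Num.nat.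
Proof.
move=> /(_ w)/intrP[z ->]; rewrite -intrB -intr_norm.
by rewrite -abszE natr_nat.
Qed.

Theorem theorem24 (R : realType) (f : R -> R)
    (hf : is_tradeoff f) (hsym : symmetric_tradeoff f)
    (hnt : nontrivial_tradeoff f)
    (d1 : measure_display) (T1 : measurableType d1) (P : probability T1 R)
    (N : {RV P >-> R}) (hN : discrete_CND f 1 N)
    (d2 : measure_display) (T2 : measurableType d2) (P' : probability T2 R)
    (N' : {RV P' >-> R}) (hN'int : integer_valued N')
    (hN' : le_on01 f (shift_tradeoff N' 1)) :
  [/\ forall a : int,
        stoch_dominates P' P (fun w => `|N' w - a%:~R|) (fun w => `|N w|),
      forall a t : int, 0 <= t ->
        (P' [set w | (`|N' w - a%:~R| <= t%:~R)%R] <=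
         P [set w | (`|N w| <= t%:~R)%R])%E,
      forall (phi : R -> R), {homo phi : x y / x <= y} -> forall a : int,
        ('E_P[fun w => phi `|N w|%R] <= 'E_P'[fun w => phi `|N' w - a%:~R|%R])%E
    & exists (d : measure_display) (S : measurableType d)
          (mu : probability S R) (N0 W B : {RV mu >-> R}),
        [/\ eq_law mu P N0 N,
            forall w, W w \is a Num.nat,
            eq_law P' mu (fun w => `|N' w|) (fun w => `|N0 w| + W w),
            fair_sign_indep mu B N0 W
          & symmetric_law P' N' ->
            eq_law P' mu N' (fun w => N0 w + sign_at0 (B w) (N0 w) * W w)]].
Proof.
have [_ _ Nint Nsym] := hN.
have dom (a : int) (t : nat) :=
  prob_int_ball_le_CND hf hsym N N' a t hN hN'int hN'.
have Nnat w : `|N w| \is a Num.nat.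
  by have := norm_sub_nat N 0 w Nint; rewrite subr0.
have N'nat a w : `|N' w - a%:~R| \is a Num.nat by rewrite norm_sub_nat.
have sd a : stoch_dominates P' P (fun w => `|N' w - a%:~R|) (fun w => `|N w|).
  move=> t; have [t0|t0] := leP 0 t; last first.
    rewrite (_ : mkset _ = set0) ?measure0//.
    by apply/seteqP; split=> w //=; apply/negP; rewrite -ltNge (lt_le_trans t0).
  (* Both variables take natural values, so a real threshold may be truncated to a natural one. *)
  have le_trunc (z : R) : z \is a Num.nat ->
      (z <= t) = (z <= (Num.truncn t)%:R).
    by move=> /natrP[n ->]; rewrite ler_nat truncn_ge_nat.
  under eq_set do rewrite le_trunc//.
  by under [X in (_ <= P X)%E]eq_set do rewrite le_trunc//; exact: dom.
have coup a := stoch_le_nat_coupling (norm_sub N 0 : {RV P >-> R})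
  (norm_sub N' a%:~R : {RV P' >-> R}).
have N0E : norm_sub N 0 = fun w => `|N w|.
  by apply/funext => w; rewrite /norm_sub subr0.
have {}coup a : exists (d : measure_display) (S : measurableType d)
    (U : probability S R) (x y : {RV U >-> R}),
  [/\ eq_law U P x (norm_sub N 0), eq_law U P' y (norm_sub N' a%:~R),
    forall u, x u \is a Num.nat, forall u, y u \is a Num.nat
    & forall u, x u <= y u].
  apply: coup => [w|w|n] /=; [by rewrite N0E|exact: N'nat|].
  by rewrite N0E; exact: dom.
split => //.
- by move=> a [t|//] _; exact: dom.
- move=> phi phi_homo a.
  (* Monotonicity makes [phi] measurable, so both expectations move to the coupled space, where the
     order is pointwise. *)
  have mphi : measurable_fun setT phi by exact: nondecreasing_measurable.
  have [d [S [U [x [y [xN yN' _ _ xy]]]]]] := coup a.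
  rewrite (_ : (fun w => phi `|N w|) = phi \o norm_sub N 0); last first.
    by rewrite N0E.
  rewrite (_ : (fun w => phi `|N' w - a%:~R|) = phi \o norm_sub N' a%:~R)//.
  rewrite -(eq_law_expectation x (norm_sub N 0 : {RV P >-> R}) phi xN mphi).
  rewrite -(eq_law_expectation y (norm_sub N' a%:~R : {RV P' >-> R}) phi yN'
    mphi).
  apply: le_expectation => [||u]; [exact: measurableT_comp..|].
  exact: phi_homo.
- have [d [S [U [x [y [xN yN' xnat ynat xy]]]]]] := coup 0.
  apply: (sign_coupling N (norm_sub N 0 : {RV P >-> R}) N'
    (norm_sub N' 0%:~R : {RV P' >-> R}) x y) => //.
  + by move=> w; rewrite /= /norm_sub subr0.
  + by move=> w; rewrite /= /norm_sub ?mulr0z subr0.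
Qed.
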